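(* Let $w$-dependence be fixed, i.e. fix model parameters $w$, and let $\ell(\cdot,\cdot;w):\mathcal{X}\times\mathcal{Y}\to\mathbb{R}$ be a loss function, where $\mathcal{Y}=\{1,\dots,C\}$. Let $\mathcal{D}=\{x_i\}_{i=1}^N\subset\mathcal{X}$, let $\Omega:\mathcal{X}\to\mathcal{Y}$ be a labeling oracle, and let $\pi\in\{0,1\}^N$ with $\sum_{i=1}^N\pi_i=B$, where $1\le B\le N$, select the core set $\mathcal{C}=\mathcal{C}(\pi)$. For any $\varepsilon>0$, if $\ell(x,y;w)$ is $K$-Lipschitz continuous in $(x,y)$ over $\mathcal{X}\times\mathcal{Y}$ equipped with $\|x\|+\varepsilon|y|$, that is, $$|\ell(x,y;w)-\ell(x',y';w)|\le K\left(\|x-x'\|+\varepsilon|y-y'|\right)\quad\text{for all }(x,y),(x',y')\in\mathcal{X}\times\mathcal{Y},$$ then $$\frac{1}{N}\sum_{i=1}^N \ell(x_i,\Omega(x_i);w)-\frac{1}{B}\sum_{i:\,\pi_i=1}\ell(x_i,\Omega(x_i);w)\;\le\; K\,W(\mathcal{C},\mathcal{D})+\varepsilon K C .$$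
   Context: $\mathcal{X}$ is a feature space with metric $\|x-x'\|$ induced by a norm $\|\cdot\|$ (a subset of a normed vector space), and $\mathcal{Y}=\{1,\dots,C\}$ carries the metric $|y-y'|$. The core set $\mathcal{C}(\pi)$ consists of the $B$ points $x_i$ with $\pi_i=1$. Let $D_x=[\|x_i-x_{i'}\|]_{i,i'=1}^{N}\in\mathbb{R}^{N\times N}$, let $\langle A,B'\rangle=\mathrm{Trace}(A^\top B')$ be the Frobenius inner product, and let $\mathbf{1}\in\mathbb{R}^N$ be the all-ones vector. The discrete Wasserstein distance between $\mathcal{C}(\pi)$ and $\mathcal{D}$ is $$W(\mathcal{C}(\pi),\mathcal{D})=\min_{\Gamma\in\mathbb{R}^{N\times N},\ \Gamma\ge 0}\left\{\langle D_x,\Gamma\rangle\ :\ \Gamma\mathbf{1}=\tfrac1N\mathbf{1},\ \Gamma^\top\mathbf{1}=\tfrac1B\pi\right\},$$ where $\Gamma\ge0$ is entrywise. ''Fixing $w$'' means that $w$ plays no role beyond determining the function $(x,y)\mapsto\ell(x,y;w)$. *)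

(* Defs.v *)
From mathcomp Require Import all_boot all_order all_algebra.
From mathcomp Require Import all_classical all_reals all_analysis.
From mathcomp Require Import zify.

Set Implicit Arguments.
Unset Strict Implicit.
Unset Printing Implicit Defensive.

Import Order.TTheory GRing.Theory Num.Theory.
Import numFieldNormedType.Exports.

Local Open Scope classical_set_scope.
Local Open Scope ring_scope.

Definition labels (C : nat) : set nat := [set y | (1 <= y <= C)%N].

Definition dist_mx (R : realType) (V : normedModType R) (N : nat)
  (x : 'I_N -> V) : 'M[R]_N := \matrix_(i, j) `|x i - x j|.

Definition frobenius (R : realType) (N : nat) (A B : 'M[R]_N) : R :=
  \tr (A^T *m B).

Definition ones (R : realType) (N : nat) : 'cV[R]_N := const_mx 1.

Definition sel_vec (R : realType) (N : nat) (s : {ffun 'I_N -> bool}) :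
  'cV[R]_N := \col_i (s i)%:R.

Definition couplings (R : realType) (N B : nat) (s : {ffun 'I_N -> bool}) :
    set 'M[R]_N :=
  [set G : 'M[R]_N |
    [/\ forall i j, 0 <= G i j,
        G *m ones R N = N%:R^-1 *: ones R N &
        G^T *m ones R N = B%:R^-1 *: sel_vec R s]].

Arguments couplings R {N} B s.

(* The minimum over couplings is written as an infimum, which is total;
   [wasserstein_min] below shows that it is attained. *)
Definition wasserstein (R : realType) (V : normedModType R) (N B : nat)
    (x : 'I_N -> V) (s : {ffun 'I_N -> bool}) : R :=
  inf [set frobenius (dist_mx x) G | G in couplings R B s].

Lemma frobeniusE (R : realType) (N : nat) (A B : 'M[R]_N) :
  frobenius A B = \sum_i \sum_j A i j * B i j.
Proof.
rewrite /frobenius /mxtrace exchange_big; apply: eq_bigr => j _ /=.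
by rewrite mxE; apply: eq_bigr => i _; rewrite mxE.
Qed.

Lemma couplingsP (R : realType) (N B : nat) (s : {ffun 'I_N -> bool})
    (G : 'M[R]_N) :
  couplings R B s G <-> [/\ forall i j, 0 <= G i j,
    forall i, \sum_j G i j = N%:R^-1 &
    forall j, \sum_i G i j = B%:R^-1 * (s j)%:R].
Proof.
have r (H : 'M[R]_N) i : (H *m ones R N) i 0 = \sum_j H i j.
  by rewrite mxE; apply: eq_bigr => j _; rewrite mxE mulr1.
split=> -[G0 Gr Gc]; split => //.
- by move=> i; rewrite -r Gr !mxE mulr1.
- move=> j; transitivity ((G^T *m ones R N) j 0); last by rewrite Gc !mxE.
  by rewrite r; apply: eq_bigr => i _; rewrite mxE.
- by apply/matrixP => i k; rewrite ord1 r Gr !mxE mulr1.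
- apply/matrixP => j k; rewrite ord1 r !mxE -Gc.
  by apply: eq_bigr => i _; rewrite mxE.
Qed.

Lemma couplings_nonempty (R : realType) (N B : nat)
    (s : {ffun 'I_N -> bool}) :
  (0 < B)%N -> (\sum_(i < N) nat_of_bool (s i))%N = B ->
  couplings R B s !=set0.
Proof.
move=> B0 sB.
have N0 : (0 < N)%N.
  by case: N s sB => // s; rewrite big_ord0 => B_eq; rewrite -B_eq in B0.
exists (\matrix_(i, j) (N%:R^-1 * (B%:R^-1 * (s j)%:R))); apply/couplingsP.
split=> [i j|i|j].
- by rewrite mxE !mulr_ge0 ?invr_ge0.
- under eq_bigr do rewrite mxE.
  rewrite -!mulr_sumr -natr_sum sB mulVf ?mulr1 // pnatr_eq0; lia.
- under eq_bigr do rewrite mxE.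
  rewrite sumr_const card_ord -[LHS]mulr_natl [LHS]mulrA mulfV ?mul1r //.
  by rewrite pnatr_eq0; lia.
Qed.

Lemma wasserstein_min (R : realType) (V : normedModType R) (N B : nat)
    (x : 'I_N -> V) (s : {ffun 'I_N -> bool}) :
  (0 < B)%N -> (\sum_(i < N) nat_of_bool (s i))%N = B ->
  exists2 G, couplings R B s G &
    frobenius (dist_mx x) G = wasserstein B x s /\
    forall G', couplings R B s G' ->
      frobenius (dist_mx x) G <= frobenius (dist_mx x) G'.
Proof.
move=> B0 sB.
have csum (T : topologicalType) (I : finType) (F : I -> T -> R) :
    (forall i, continuous (F i)) -> continuous (fun t => \sum_i F i t).
  move=> Fc t; apply: cvg_big => [|i _]; last exact: Fc.
  exact: add_continuous.
have ccoord i j : continuous (fun v : 'rV[R]_(N * N) => vec_mx v i j).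
  under eq_fun do rewrite mxE.
  exact: coord_continuous.
pose K := [set v : 'rV[R]_(N * N) | couplings R B s (vec_mx v)].
have cK : compact K.
  apply: (@subclosed_compact _ _ [set v : 'rV[R]_(N * N) |
      forall k, `[0, 1]%classic (v ord0 k)]).
  - have -> : K = (\bigcap_(ij in [set: 'I_N * 'I_N])
          ((fun v : 'rV[R]_(N * N) => vec_mx v ij.1 ij.2) @^-1` [set r | 0 <= r]))
      `&` ((\bigcap_(i in [set: 'I_N])
          ((fun v : 'rV[R]_(N * N) => \sum_j vec_mx v i j) @^-1` [set N%:R^-1]))
      `&` (\bigcap_(j in [set: 'I_N])
          ((fun v : 'rV[R]_(N * N) => \sum_i vec_mx v i j)
             @^-1` [set B%:R^-1 * (s j)%:R]))).
      apply/seteqP; split=> v /=.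
        move=> /couplingsP[v0 vr vc]; split; first by move=> [i j] _; exact: v0.
        by split=> i _; [exact: vr|exact: vc].
      move=> [v0 [vr vc]]; apply/couplingsP; split.
      + by move=> i j; exact: (v0 (i, j)).
      + by move=> i; exact: vr.
      + by move=> j; exact: vc.
    apply: closedI; [|apply: closedI]; apply: closed_bigI => i _.
    + by apply: (continuous_closedP _).1; [exact: ccoord|exact: closed_ge].
    + apply: (continuous_closedP _).1; last exact: closed_eq.
      by apply: csum => j; exact: ccoord.
    + apply: (continuous_closedP _).1; last exact: closed_eq.
      by apply: csum => j; exact: ccoord.
  - apply: (@rV_compact R (N * N)%N (fun=> `[0%R, 1%R]%classic)) => _.
    exact: segment_compact.
  - move=> v /couplingsP[v0 vr _] k.
    case/mxvec_indexP: k => i j.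
    have -> : v ord0 (mxvec_index i j) = vec_mx v i j by rewrite mxE.
    rewrite /= in_itv /= v0 /=.
    have N1 : N%:R^-1 <= 1 :> R.
      by rewrite invf_le1 ?ler1n ?ltr0n; case: (N) i => // -[].
    apply: le_trans N1; rewrite -(vr i) (bigD1 j) //= lerDl.
    by apply: sumr_ge0.
have K0 : K !=set0.
  have [G Gs] := couplings_nonempty R B0 sB.
  by exists (mxvec G); rewrite /K /= mxvecK.
pose f (v : 'rV[R]_(N * N)) := frobenius (dist_mx x) (vec_mx v).
have fc : continuous f.
  rewrite /f; under eq_fun do rewrite frobeniusE.
  apply: (csum _ _ _) => i; apply: (csum _ _ _) => j v.
  by apply: continuousM; [exact: cst_continuous|exact: ccoord].
have [v /set_mem Kv vmin] :=
  compact_EVT_min K0 cK (continuous_subspaceT fc).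
have Gmin G' : couplings R B s G' ->
    frobenius (dist_mx x) (vec_mx v) <= frobenius (dist_mx x) G'.
  move=> sG'; have := vmin (mxvec G'); rewrite /f mxvecK; apply.
  by apply/mem_set; rewrite /K /= mxvecK.
exists (vec_mx v) => //; split=> //; apply/le_anti/andP; split.
- apply: lb_le_inf; first by exists (f v); exists (vec_mx v).
  by move=> _ [G' sG' <-]; exact: Gmin.
- apply: ge_inf; last by exists (vec_mx v).
  by exists (f v) => _ [G' sG' <-]; exact: Gmin.
Qed.

(* Main.v *)
(** A coupling [G] of the two empirical measures writes the difference of the
    average losses as [\sum_i \sum_j G i j * (l_i - l_j)].  The Lipschitz bound,
    with label distances at most [C], bounds each [l_i - l_j] by
    [K * `|x_i - x_j| + eps * K * C]; for the optimal [G], of total mass 1, this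
    sums to the claim. *)

Require Import Defs.
From mathcomp Require Import all_boot all_order all_algebra.
From mathcomp Require Import all_classical all_reals all_analysis.
From mathcomp Require Import lra.

Set Implicit Arguments.
Unset Strict Implicit.
Unset Printing Implicit Defensive.

Import Order.TTheory GRing.Theory Num.Theory.
Import numFieldNormedType.Exports.

Local Open Scope classical_set_scope.
Local Open Scope ring_scope.

(** Both labels lie in the real interval from 0 to [C], which has length [C]. *)
Lemma label_dist_le (R : realType) (C y y' : nat) :
  labels C y -> labels C y' -> `|y%:R - y'%:R| <= C%:R :> R.
Proof.
move=> /andP[_ yC] /andP[_ y'C]; rewrite ler_norml.
have := ler0n R y; have := ler0n R y'.
move: yC y'C; rewrite -!(ler_nat R); lra.
Qed.

(** Row sums of [G] turn the [f i] part into the full mean; column sums carry the indicator of [s],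
    which restricts the [f j] part to the core set. *)
Lemma coupling_mean_diff (R : realType) (N B : nat) (s : {ffun 'I_N -> bool})
    (G : 'M[R]_N) (f : 'I_N -> R) :
  couplings R B s G ->
  N%:R^-1 * (\sum_i f i) - B%:R^-1 * (\sum_(i | s i) f i) =
  \sum_i \sum_j G i j * (f i - f j).
Proof.
move=> /couplingsP[_ Gr Gc].
under [RHS]eq_bigr do under eq_bigr do rewrite mulrBr.
under [RHS]eq_bigr do rewrite sumrB -mulr_suml Gr.
rewrite sumrB mulr_sumr; congr (_ - _).
rewrite exchange_big mulr_sumr big_mkcond /=; apply: eq_bigr => j _.
by rewrite -mulr_suml Gc; case: (s j); rewrite ?mulr1 // mulr0 mul0r.
Qed.

Lemma coupling_mass (R : realType) (N B : nat) (s : {ffun 'I_N -> bool})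
    (G : 'M[R]_N) :
  (0 < N)%N -> couplings R B s G -> \sum_i \sum_j G i j = 1.
Proof.
move=> N0 /couplingsP[_ Gr _]; under eq_bigr do rewrite Gr.
by rewrite sumr_const card_ord -[LHS]mulr_natl mulfV // pnatr_eq0 -lt0n.
Qed.

Theorem theorem1 (R : realType) (V : normedModType R) (X : set V) (C : nat)
    (Theta : Type) (ell : V -> nat -> Theta -> R) (w : Theta)
    (N B : nat) (x : 'I_N -> V) (Omega : V -> nat)
    (s : {ffun 'I_N -> bool}) (eps K : R)
    (xX : forall i, X (x i))
    (OmegaY : forall v, X v -> labels C (Omega v))
    (sB : (\sum_(i < N) nat_of_bool (s i))%N = B)
    (B_ge1 : (1 <= B)%N) (B_leN : (B <= N)%N)
    (eps_gt0 : 0 < eps) (K_ge0 : 0 <= K)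
    (ell_lip : forall v v' y y', X v -> X v' -> labels C y -> labels C y' ->
       `|ell v y w - ell v' y' w| <=
         K * (`|v - v'| + eps * `|y%:R - y'%:R|)) :
  N%:R^-1 * (\sum_(i < N) ell (x i) (Omega (x i)) w)
    - B%:R^-1 * (\sum_(i < N | s i) ell (x i) (Omega (x i)) w)
  <= K * wasserstein B x s + eps * K * C%:R.
Proof.
have [G sG [<- _]] := wasserstein_min x B_ge1 sB.
(* Spread the additive constant over the unit mass of [G], so that both sides become double sums,
   comparable entry by entry. *)
have -> : eps * K * C%:R = eps * K * C%:R * \sum_i \sum_j G i j.
  by rewrite (coupling_mass (leq_trans B_ge1 B_leN) sG) mulr1.
rewrite (coupling_mean_diff _ sG) frobeniusE !mulr_sumr -big_split.
apply: ler_sum => i _ /=; rewrite !mulr_sumr -big_split.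
apply: ler_sum => j _ /=; have /couplingsP[G_ge0 _ _] := sG.
(* Factor out the weight [G i j]; as it is nonnegative, a bound on the loss difference of the pair
   suffices. *)
rewrite mxE mulrA [_ * C%:R * _]mulrC [_ * G i j]mulrC -mulrDr.
apply: ler_wpM2l => //; apply: le_trans (ler_norm _) _.
have Y k : labels C (Omega (x k)) by exact/OmegaY/xX.
apply: le_trans (ell_lip _ _ _ _ (xX i) (xX j) (Y i) (Y j)) _.
(* The feature terms cancel, leaving only the label distance to bound by [C]. *)
rewrite mulrDr lerD2l mulrA [K * eps]mulrC ler_wpM2l ?mulr_ge0 ?(ltW eps_gt0) //.
exact: label_dist_le.
Qed.
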